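(* Let $G$ and $H$ be finite simple graphs, neither of which is the path on three vertices $P_3$ or the $4$-cycle $C_4$. Let $S$ be a minimum edge-cut in $G\times H$, and let $B$ and $W$ be the (two) connected components of $(G\times H)-S$. Then $S$ is of type 1, 2, 3, 4, 5, 6, 7 or 8.
   Context: The direct product $G\times H$ has vertex set $V(G)\times V(H)$, with $(x_1,y_1)$ adjacent to $(x_2,y_2)$ if and only if $x_1x_2\in E(G)$ and $y_1y_2\in E(H)$. An edge-cut is a set of edges whose removal disconnects the graph; a minimum edge-cut is one of minimum size. When $S$ is a minimum edge-cut of $G\times H$, its ''connected components'' $B$ (black) and $W$ (white) are the two connected components of $(G\times H)-S$ (the convention presupposes exactly two components). The types are the following shapes of the pair $(B,W)$ (up to interchanging the names $B$ and $W$), where all sets written as partitions are disjoint unions: Type 1: $B=B'\times V(H)$, $W=W'\times V(H)$ with $V(G)=B'\cup W'$. Type 2: $B=V(G)\times B'$, $W=V(G)\times W'$ with $V(H)=B'\cup W'$. Type 3: $|B|=1$ or $|W|=1$. Type 4: $V(G)=X_1\cup X_2$, $V(H)=Y_1\cup Y_2$, $B=(X_1\times Y_1)\cup(X_2\times Y_2)$, $W=(X_1\times Y_2)\cup(X_2\times Y_1)$. Type 5: $V(G)=A_1\cup A_2\cup A_3$, $V(H)=C\cup D$, $B=(A_1\times C)\cup(A_2\times D)$, $W=(A_1\times D)\cup(A_2\times C)\cup(A_3\times V(H))$. Type 6: $V(G)=X\cup Y$, $V(H)=C_1\cup C_2\cup C_3$, $B=(X\times C_1)\cup(Y\times C_2)$,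 $W=(X\times C_2)\cup(Y\times C_1)\cup(V(G)\times C_3)$. Type 7: $V(G)=A_1\cup A_2\cup A_3\cup A_4$, $V(H)=C\cup D$, $B=(A_1\times C)\cup(A_2\times D)\cup(A_4\times V(H))$, $W=(A_1\times D)\cup(A_2\times C)\cup(A_3\times V(H))$. Type 8: $V(G)=X\cup Y$, $V(H)=C_1\cup C_2\cup C_3\cup C_4$, $B=(X\times C_1)\cup(Y\times C_2)\cup(V(G)\times C_4)$, $W=(X\times C_2)\cup(Y\times C_1)\cup(V(G)\times C_3)$. (In the paper these types are given by a figure: in types 5 and 7 each $H$-layer $\{x\}\times V(H)$ is either monochromatic or split along a fixed partition $C\cup D$, and types 6 and 8 are the analogous shapes with the roles of $G$ and $H$ interchanged.) *)

(* Defs.v *)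
From mathcomp Require Import all_boot.
Set Implicit Arguments. Unset Strict Implicit. Unset Printing Implicit Defensive.

Definition simple_graph (T : finType) (e : rel T) : Prop :=
  symmetric e /\ irreflexive e.

Definition graph_iso (T1 T2 : finType) (g : rel T1) (h : rel T2) : Prop :=
  exists f : T1 -> T2, bijective f /\ forall x y, h (f x) (f y) = g x y.

Definition P3_rel : rel 'I_3 := fun i j => (i.+1 == j :> nat) || (j.+1 == i :> nat).
Definition C4_rel : rel 'I_4 :=
  fun i j => ((i.+1 %% 4)%N == j :> nat) || ((j.+1 %% 4)%N == i :> nat).

Definition dprod_rel (T1 T2 : finType) (g : rel T1) (h : rel T2) : rel (T1 * T2) :=
  fun p q => g p.1 q.1 && h p.2 q.2.

Definition is_edge_set (V : finType) (e : rel V) (S : {set {set V}}) : Prop :=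
  forall s, s \in S -> exists x y, e x y /\ s = [set x; y].

Definition del_edges (V : finType) (e : rel V) (S : {set {set V}}) : rel V :=
  fun x y => e x y && ([set x; y] \notin S).

Definition disconnected (V : finType) (e : rel V) : Prop :=
  exists x y, ~~ connect e x y.

Definition edge_cut (V : finType) (e : rel V) (S : {set {set V}}) : Prop :=
  is_edge_set e S /\ disconnected (del_edges e S).

Definition min_edge_cut (V : finType) (e : rel V) (S : {set {set V}}) : Prop :=
  edge_cut e S /\ forall S', edge_cut e S' -> #|S| <= #|S'|.

Definition is_component (V : finType) (e : rel V) (C : {set V}) : Prop :=
  C != set0 /\ forall x, x \in C -> forall y, connect e x y = (y \in C).

(* partitions of the full vertex set into (possibly empty) disjoint parts *)
Definition part2 (T : finType) (X1 X2 : {set T}) : Prop :=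
  [disjoint X1 & X2] /\ X1 :|: X2 = setT.
Definition part3 (T : finType) (X1 X2 X3 : {set T}) : Prop :=
  [/\ [disjoint X1 & X2], [disjoint X1 & X3], [disjoint X2 & X3]
    & X1 :|: X2 :|: X3 = setT].
Definition part4 (T : finType) (X1 X2 X3 X4 : {set T}) : Prop :=
  [/\ [/\ [disjoint X1 & X2], [disjoint X1 & X3] & [disjoint X1 & X4]],
      [/\ [disjoint X2 & X3], [disjoint X2 & X4] & [disjoint X3 & X4]]
    & X1 :|: X2 :|: X3 :|: X4 = setT].

Section Types.
Variables (T1 T2 : finType).
Implicit Types (B W : {set T1 * T2}).

Definition type1 B W : Prop := exists B' W' : {set T1},
  [/\ part2 B' W', B = setX B' setT & W = setX W' setT].
Definition type2 B W : Prop := exists B' W' : {set T2},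
  [/\ part2 B' W', B = setX setT B' & W = setX setT W'].
Definition type3 B W : Prop := #|B| = 1 \/ #|W| = 1.
Definition type4 B W : Prop := exists (X1 X2 : {set T1}) (Y1 Y2 : {set T2}),
  [/\ part2 X1 X2, part2 Y1 Y2,
      B = setX X1 Y1 :|: setX X2 Y2 & W = setX X1 Y2 :|: setX X2 Y1].
Definition type5 B W : Prop := exists (A1 A2 A3 : {set T1}) (C D : {set T2}),
  [/\ part3 A1 A2 A3, part2 C D,
      B = setX A1 C :|: setX A2 D
    & W = setX A1 D :|: setX A2 C :|: setX A3 setT].
Definition type6 B W : Prop := exists (X Y : {set T1}) (C1 C2 C3 : {set T2}),
  [/\ part2 X Y, part3 C1 C2 C3,
      B = setX X C1 :|: setX Y C2
    & W = setX X C2 :|: setX Y C1 :|: setX setT C3].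
Definition type7 B W : Prop := exists (A1 A2 A3 A4 : {set T1}) (C D : {set T2}),
  [/\ part4 A1 A2 A3 A4, part2 C D,
      B = setX A1 C :|: setX A2 D :|: setX A4 setT
    & W = setX A1 D :|: setX A2 C :|: setX A3 setT].
Definition type8 B W : Prop := exists (X Y : {set T1}) (C1 C2 C3 C4 : {set T2}),
  [/\ part2 X Y, part4 C1 C2 C3 C4,
      B = setX X C1 :|: setX Y C2 :|: setX setT C4
    & W = setX X C2 :|: setX Y C1 :|: setX setT C3].

Definition cut_shape B W : Prop :=
  type1 B W \/ type2 B W \/ type3 B W \/ type4 B W \/
  type5 B W \/ type6 B W \/ type7 B W \/ type8 B W.
End Types.

(* Main.v *)
Require Import Defs.
From mathcomp Require Import all_boot.
From mathcomp Require Import zify.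
Set Implicit Arguments. Unset Strict Implicit. Unset Printing Implicit Defensive.

(* Read a cut as a black/white coloring M of V(G) x V(H).  Types 1-8 amount to
   saying that M has at most two distinct rows (type 8) or at most two distinct
   columns (type 7).  If G or H is disconnected the cut is empty and is of type
   1 or 2.  Otherwise let a, b be the minimum degrees; the cut has at most a b
   edges.  For a row f, let t(f) be the sum over y in V(H) of the size of the
   minority color in N(y); every edge of G at that row carries at least t(f)
   cut edges, and t(f) = 0 forces f to be constant on even-walk classes of H.
   If all rows (or all columns) have t = 0 we are done.  If some row has
   t >= b, then all cut edges are at that row, and flipping one vertex gives an
   empty cut, unless H is K_2, P_3 or C_4; similarly for columns.  Finally, if
   0 < t < b then each color occurs at least b times in the row, so that an edge
   between a row with t > 0 and one with t = 0 carries b^2 cut edges.  As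
   a^2 + 2 b^2 > 2 a b, this excludes a mixture of both kinds of rows, and
   likewise of columns.  If no row and no column has t = 0, counting forces
   |G| = |H| = 2a = 2b and exactly one cut edge on each edge of G, which
   contradicts parity. *)

(** * Rows: two-colorings of the vertices of one graph *)

Definition deg (T : finType) (h : rel T) (y : T) : nat := \sum_z h y z.

(** The cut edges of the product above one edge of G whose ends carry the rows [f] and [f']. *)
Definition row_cut (T : finType) (h : rel T) (f f' : T -> bool) : nat :=
  \sum_y \sum_z h y z * (f y (+) f' z).

(** This is t(f) of the overview. A row of value [0] is called good below, any other row bad. *)
Definition minority (T : finType) (h : rel T) (f : T -> bool) : nat :=
  \sum_y minn (\sum_z h y z * f z) (\sum_z h y z * ~~ f z).

Lemma deg_pos_neighbour (T : finType) (h : rel T) y :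
  0 < deg h y -> exists z, h y z.
Proof.
rewrite lt0n => dy; apply/existsP; apply: contraR dy.
rewrite negb_exists => /forallP none; rewrite /deg big1 // => z _.
by rewrite (negbTE (none z)).
Qed.

Section OneGraph.
Variables (T : finType) (h : rel T).
Hypothesis h_sym : symmetric h.
Implicit Types f q : T -> bool.

Lemma row_cutC f f' : row_cut h f f' = row_cut h f' f.
Proof.
rewrite /row_cut exchange_big /=; apply: eq_bigr => y _; apply: eq_bigr => z _.
by rewrite h_sym addbC.
Qed.

Lemma minority_le_row_cut f f' : minority h f' <= row_cut h f f'.
Proof.
apply: leq_sum => y _; case: (f y).
  exact: geq_minr.
exact: geq_minl.
Qed.

(** The row that attains the lower bound in [minority_le_row_cut]. *)
Definition majority f y : bool := \sum_z h y z * ~~ f z <= \sum_z h y z * f z.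

Lemma row_cut_majority f : row_cut h (majority f) f = minority h f.
Proof.
rewrite /minority; apply: eq_bigr => y _; rewrite /majority.
by case: leqP.
Qed.

Lemma minority0P f :
  minority h f = 0 <->
  (forall y z1 z2, h y z1 -> h y z2 -> f z1 = f z2).
Proof.
split=> [/eqP|mono].
  rewrite sum_nat_eq0 => /forallP t0 y z1 z2 h1 h2.
  have /= := t0 y; rewrite -leqn0 geq_min !leqn0 !sum_nat_eq0.
  case/orP=> /forallP n0; have := n0 z1; have := n0 z2; rewrite h1 h2 !mul1n;
  by case: (f z1) (f z2) => [] [].
apply/eqP; rewrite sum_nat_eq0; apply/forallP => y /=.
case: (pickP (h y)) => [z hz|none]; last first.
  rewrite big1 ?min0n // => z _; by rewrite none.
rewrite -leqn0 geq_min !leqn0 !sum_nat_eq0; case fz: (f z).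
  apply/orP; right; apply/forallP => z' /=.
  case hz': (h y z') => //; by rewrite (mono _ _ _ hz' hz) fz.
apply/orP; left; apply/forallP => z' /=.
case hz': (h y z') => //; by rewrite (mono _ _ _ hz' hz) fz.
Qed.

(** Since [q] is constant on each neighborhood, adding it keeps or swaps the two color counts there,
    and [minn] is symmetric. *)
Lemma minority_addb f q :
  minority h q = 0 -> minority h (fun y => f y (+) q y) = minority h f.
Proof.
move/minority0P => mono; apply: eq_bigr => y _.
case: (pickP (h y)) => [z hz|none]; last first.
  by rewrite !big1 // => z _; rewrite none.
case qz: (q z).
  rewrite minnC; congr minn; apply: eq_bigr => z' _;
  case hz': (h y z') => //; rewrite (mono _ _ _ hz' hz) qz //; by case: (f z').
congr minn; apply: eq_bigr => z' _;
case hz': (h y z') => //; rewrite (mono _ _ _ hz' hz) qz //; by case: (f z').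
Qed.

Lemma minority_neg f : minority h (fun y => ~~ f y) = minority h f.
Proof.
rewrite -[RHS](@minority_addb f (fun=> true)); last exact/minority0P.
by apply: eq_bigr => y _; congr minn; apply: eq_bigr => z _; rewrite addbT.
Qed.

(* For [f'] with [minority h f' = 0], [expected f'] is a row [f] with
   [row_cut h f f' = 0], the only one when no vertex is isolated. *)
Definition expected f' y : bool := [exists z, h y z && f' z].

(** As [f'] is constant on the neighborhood of [y], either all edges at [y] are cut or none. *)
Lemma row_cut_expected f f' :
  minority h f' = 0 ->
  row_cut h f f' = \sum_y deg h y * (f y (+) expected f' y).
Proof.
move/minority0P=> mono; apply: eq_bigr => y _; rewrite /deg big_distrl /=.
apply: eq_bigr => z _; case hz: (h y z) => //; rewrite !mul1n.
suff -> : expected f' y = f' z by [].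
apply/existsP/idP => [[z' /andP[hz' fz']]|fz]; first by rewrite (mono _ _ _ hz hz').
by exists z; rewrite hz.
Qed.

(** Two neighbors of [w] have [w] as a common neighbor, so the color [f' w] is expected at both. *)
Lemma minority_expected f' : minority h f' = 0 -> minority h (expected f') = 0.
Proof.
move/minority0P=> mono; apply/minority0P => w y1 y2 h1 h2.
apply/existsP/existsP => [[z /andP[hz fz]]|[z /andP[hz fz]]]; exists w.
  by rewrite h_sym h2 (mono y1 _ z) // h_sym.
by rewrite h_sym h1 (mono y2 _ z) // h_sym.
Qed.

Variable d : nat.
Hypothesis d_min : forall y, d <= deg h y.

(** A vertex colored [true] by [f] has at least [d] neighbors, of which at most [\sum_y f' y] are
    colored [true] by [f']. *)
Lemma row_cut_ge_left f f' : (\sum_y f y) * (d - \sum_y f' y) <=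
   \sum_y \sum_z h y z * (f y && ~~ f' z).
Proof.
rewrite big_distrl /=; apply: leq_sum => y _; case: (f y) => //=.
rewrite mul1n leq_subLR -big_split /=; apply: (leq_trans (d_min y)).
apply: leq_sum => z _; by case: (h y z); case: (f' z).
Qed.

Lemma row_cut_ge f f' :
  (\sum_y f y) * (d - \sum_y f' y) + (\sum_y f' y) * (d - \sum_y f y)
  <= row_cut h f f'.
Proof.
apply: (leq_trans (leq_add (row_cut_ge_left _ _) (row_cut_ge_left _ _))).
rewrite [X in _ + X]exchange_big -big_split /=; apply: leq_sum => y _.
rewrite -big_split /=; apply: leq_sum => z _.
by rewrite h_sym; case: (h z y) (f y) (f' z) => [] [] [].
Qed.

(** Let p and q count the vertices colored [true] by [f] and by [majority f]. Then [row_cut_ge]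
    bounds q(d-p) + p(d-q) by the minority of [f], but for 0 < p < d this sum is at least d. *)
Lemma minority_small_count f :
  0 < minority h f < d -> d <= \sum_y f y.
Proof.
case/andP=> t0 td; rewrite leqNgt; apply/negP => pd.
have p0 : 0 < \sum_y f y.
  rewrite lt0n; apply/negP; rewrite sum_nat_eq0 => /forallP f0.
  move: t0; rewrite (_ : minority h f = 0) //; apply/minority0P => y z1 z2 _ _.
  by have := f0 z1; have := f0 z2; case: (f z1) (f z2) => [] [].
have := row_cut_ge (majority f) f; rewrite row_cut_majority.
move: (\sum_y f y) (\sum_y majority f y) (minority h f) p0 pd td => p q t.
move=> p0 pd td.
case: (leqP d q) => qd H.
  have : q <= q * (d - p) by rewrite leq_pmulr // subn_gt0.
  lia.
case: (posnP q) => q0; first by rewrite q0 subn0 in H; nia.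
(* With d = p+u+1 = q+v+1 the two products are at least q+u and p+v, and 2d-2 >= d since d >= 2. *)
have [u du] : exists u, d = p + u.+1 by exists (d - p).-1; lia.
have [v dv] : exists v, d = q + v.+1 by exists (d - q).-1; lia.
have e1 : d - p = u.+1 by lia.
have e2 : d - q = v.+1 by lia.
rewrite e1 e2 in H.
have : q + u <= q * u.+1 by nia.
have : p + v <= p * v.+1 by nia.
lia.
Qed.

(** Negation preserves the minority, so each of the two colors occurs at least [d] times. *)
Lemma minority_small_card f :
  0 < minority h f < d -> 2 * d <= #|T|.
Proof.
move=> tf; have tn : 0 < minority h (fun y => ~~ f y) < d by rewrite minority_neg.
have := leq_add (minority_small_count tf) (minority_small_count tn).
rewrite -big_split /= addnn -mul2n => /leq_trans; apply.
rewrite -sum1_card; apply: leq_sum => y _; by case: (f y).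
Qed.

(** The difference of [f] and [expected f'] has the same minority as [f], hence is [true] at [d]
    vertices or more, and each of these costs its degree. *)
Lemma row_cut_bad_good f f' :
  0 < minority h f < d -> minority h f' = 0 -> d * d <= row_cut h f f'.
Proof.
move=> tf t0; rewrite row_cut_expected //.
have tq : 0 < minority h (fun y => f y (+) expected f' y) < d.
  by rewrite minority_addb // minority_expected.
apply: (@leq_trans (d * \sum_y (f y (+) expected f' y))).
  by rewrite leq_mul2l minority_small_count // orbT.
rewrite big_distrr /=; apply: leq_sum => y _; by rewrite leq_mul2r d_min orbT.
Qed.

End OneGraph.

(** * Connected graphs: twin pairs and boundaries *)

Section ConnectedGraph.
Variables (T : finType) (h : rel T).
Hypothesis h_sym : symmetric h.
Hypothesis h_irr : irreflexive h.
Hypothesis h_conn : forall x y, connect h x y.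

Lemma closed_full (A : {set T}) x :
  x \in A -> (forall y z, y \in A -> h y z -> z \in A) -> forall y, y \in A.
Proof.
move=> xA clA y; have cl : closed h A.
  by apply: (intro_closed (sym_connect_sym h_sym)) => u v huv uA; apply: (clA u).
by rewrite -(closed_connect cl (h_conn x y)).
Qed.

Lemma connected_neighbour x y : x != y -> exists z, h x z.
Proof.
move=> xy; have /connectP[[|z p]] := h_conn x y; first by move=> _ /= yx; rewrite yx eqxx in xy.
by case/andP=> hxz _ _; exists z.
Qed.

Lemma degE y : deg h y = #|[set z | h y z]|.
Proof.
rewrite /deg -sum1dep_card [RHS]big_mkcond /=.
by apply: eq_bigr => z _; case: (h y z).
Qed.

Lemma graph_iso_enum n (r : rel 'I_n.+1) (s : n.+1.-tuple T) :
  uniq s -> (forall x, x \in s) ->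
  (forall i j, r i j = h (tnth s i) (tnth s j)) -> graph_iso h r.
Proof.
move=> us sT rs; pose f x : 'I_n.+1 := inord (index x s).
have fK x : tnth s (f x) = x.
  rewrite (tnth_nth x) /f inordK ?nth_index //.
  by rewrite -{2}(size_tuple s) index_mem.
exists f; split; last by move=> x y; rewrite rs !fK.
exists (tnth s) => // i; apply/val_inj.
rewrite /f /= (tnth_nth (tnth s ord0)) index_uniq ?size_tuple // inordK //.
Qed.

(** A neighborhood that meets {y1, y2} lies inside it. So a neighbor of [y1] has degree at most 2,
    whence d <= 2, and connectivity leaves only the listed graphs. *)
Lemma twin_pair_graph d y1 y2 :
  (forall y, d <= deg h y) -> y1 != y2 -> deg h y1 = d -> deg h y2 = d ->
  minority h (fun y => (y == y1) || (y == y2)) = 0 ->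
  [\/ #|T| <= 2, graph_iso h P3_rel | graph_iso h C4_rel].
Proof.
move=> d_min y12 dy1 dy2 /minority0P mono.
have Nsub y z : h y z -> (z == y1) || (z == y2) ->
    [set z | h y z] \subset [set y1; y2].
  move=> hz zD; apply/subsetP => z'; rewrite !inE => hz'.
  by rewrite (mono y z' z hz' hz) zD.
have dle2 : d <= 2.
  have [z hz] := connected_neighbour y12.
  apply: (leq_trans (d_min z)); rewrite degE.
  apply: leq_trans (subset_leq_card (Nsub z y1 _ _)) _; rewrite ?eqxx //.
    by rewrite h_sym.
  by rewrite cards2; case: eqP.
(* If [y1] and [y2] are adjacent, the pair is closed under adjacency and is the whole graph. *)
have [hy|nhy] := boolP (h y1 y2).
  constructor 1; have N1 := Nsub y1 y2 hy; have N2 := Nsub y2 y1.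
  rewrite h_sym hy !eqxx ?orbT /= in N1 N2.
  have full : forall y, y \in [set y1; y2].
    apply: (@closed_full _ y1); first by rewrite !inE eqxx.
    move=> y z; rewrite in_set2 => /orP[]/eqP-> hz.
      by apply: (subsetP (N1 isT)); rewrite inE.
    by apply: (subsetP (N2 isT isT)); rewrite inE.
  rewrite -cardsT; apply: leq_trans (subset_leq_card (B := [set y1; y2]) _) _.
    by apply/subsetP => y _; apply: full.
  by rewrite cards2; case: eqP.
have [z1 hz1] := connected_neighbour y12.
have z1y1 : z1 != y1 by apply: contraTneq hz1 => ->; rewrite h_irr.
have z1y2 : z1 != y2 by apply: contraTneq hz1 => ->.
have Nz z : h y1 z -> [set w | h z w] \subset [set y1; y2].
  by rewrite h_sym => hz; apply: (Nsub _ y1 hz); rewrite eqxx.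
have d0 : 0 < d.
  by rewrite -dy1 degE card_gt0; apply/set0Pn; exists z1; rewrite inE.
have [d1|d2] : d = 1 \/ d = 2 by lia.
  constructor 2.
  have /cards1P[z N1] : #|[set z | h y1 z]| == 1 by rewrite -degE dy1 d1.
  have h1 w : h y1 w = (w == z1).
    have : z1 \in [set z | h y1 z] by rewrite inE.
    rewrite N1 inE => /eqP->; have := in_set (h y1) w.
    by rewrite N1 inE => <-.
  have hy2z1 : h y2 z1.
    (* Otherwise {y1, z1} would be closed under adjacency and miss [y2]. *)
    apply/negPn/negP => nh.
    have := @closed_full [set y1; z1] y1 _ _ y2.
    rewrite !inE eqxx !(eq_sym y2) (negbTE y12) (negbTE z1y2).
    move/(_ isT) => H; suff: false by []. apply: H => u v; rewrite !inE => /orP[]/eqP->.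
      by rewrite h1 => ->; rewrite orbT.
    move=> hv; have := subsetP (Nz _ hz1) v; rewrite !inE hv => /(_ isT)/orP[->//|/eqP ev].
    by move: nh; rewrite h_sym -ev hv.
  have /cards1P[z' N2] : #|[set z | h y2 z]| == 1 by rewrite -degE dy2 d1.
  have h2 w : h y2 w = (w == z1).
    have : z1 \in [set z | h y2 z] by rewrite inE.
    rewrite N2 inE => /eqP->; have := in_set (h y2) w.
    by rewrite N2 inE => <-.
  have full : forall y, y \in [:: y1; z1; y2].
    move=> y; suff: y \in [set y1; z1; y2] by rewrite !inE -orbA.
    apply: (@closed_full _ y1); first by rewrite !inE eqxx.
    move=> u v; rewrite !inE -orbA => /or3P[]/eqP->.
    - by rewrite h1 => ->; rewrite orbT.
    - move=> hv; have := subsetP (Nz _ hz1) v.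
      by rewrite !inE hv => /(_ isT)/orP[]->; rewrite ?orbT.
    - by rewrite h2 => ->; rewrite orbT.
  apply: (@graph_iso_enum _ _ [tuple y1; z1; y2]) => //.
    by rewrite /= !inE negb_or (eq_sym y1 z1) z1y1 y12 z1y2.
  move=> i j; rewrite !(tnth_nth y1).
  case: i => [[|[|[|i]]]] // ?; case: j => [[|[|[|j]]]] // ? /=;
  by rewrite /P3_rel /= ?h_irr ?(h_sym z1) ?h1 ?h2 ?eqxx ?(eq_sym _ z1) ?(negbTE z1y1) ?(negbTE z1y2).
constructor 3.
have : #|[set z | h y1 z]| == 2 by rewrite -degE dy1 d2.
case/cards2P=> u1 [u2 [u12 N1]].
have h1 w : h y1 w = (w == u1) || (w == u2).
  by have := in_set (h y1) w; rewrite N1 !inE => <-.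
(* Minimum degree 2 turns the inclusion in {y1, y2} into an equality. *)
have hu u : h y1 u -> forall w, h u w = (w == y1) || (w == y2).
  move=> hu w; have e : [set w | h u w] = [set y1; y2].
    apply/eqP; rewrite eqEcard Nz //= cards2 y12 /= -degE.
    by rewrite -[X in X.+1 <= _]/1 -d2.
  by have := in_set (h u) w; rewrite e !inE => <-.
have hu1 := hu u1; have hu2 := hu u2.
rewrite !h1 !eqxx orbT in hu1 hu2.
have e2 : [set z | h y2 z] = [set u1; u2].
  apply/esym/eqP; rewrite eqEcard -degE dy2 d2 cards2 u12 andbT.
  apply/subsetP => w; rewrite !inE => /orP[]/eqP->.
    by rewrite h_sym hu1 // eqxx orbT.
  by rewrite h_sym hu2 // eqxx orbT.
have h2 w : h y2 w = (w == u1) || (w == u2).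
  by have := in_set (h y2) w; rewrite e2 !inE => <-.
have {}hu1 := hu1 isT; have {}hu2 := hu2 isT.
have ny1 : (y1 == u1) = false /\ (y1 == u2) = false.
  by have := h_irr y1; rewrite h1 => /norP[/negbTE-> /negbTE->].
have ny2 : (y2 == u1) = false /\ (y2 == u2) = false.
  by have := h_irr y2; rewrite h2 => /norP[/negbTE-> /negbTE->].
have full : forall y, y \in [:: y1; u1; y2; u2].
  move=> y; suff: y \in [set y1; u1; y2; u2] by rewrite !inE -!orbA.
  apply: (@closed_full _ y1); first by rewrite !inE eqxx.
  move=> u v; rewrite !inE -!orbA => /or4P[]/eqP->;
  by rewrite ?h1 ?h2 ?hu1 ?hu2 => /orP[]->; rewrite ?orbT.
apply: (@graph_iso_enum _ _ [tuple y1; u1; y2; u2]) => //.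
  by rewrite /= !inE !negb_or y12 u12 ny1.1 ny1.2 (eq_sym u1) ny2.1 ny2.2.
move=> i j; rewrite !(tnth_nth y1).
case: i => [[|[|[|[|i]]]]] // ?; case: j => [[|[|[|[|j]]]]] // ? /=;
by rewrite /C4_rel /= ?h1 ?h2 ?hu1 ?hu2 ?eqxx ?orbT ?(eq_sym u1) ?(eq_sym u2) ?ny1.1 ?ny1.2 ?ny2.1 ?ny2.2 ?(eq_sym y2 y1) ?(negbTE y12) ?(eq_sym u2 u1) ?(negbTE u12).
Qed.

(* The rows outside [R] are far from those inside, which makes the boundary
   of [R] expensive: if [R] is small its boundary is large, and if [R] is
   large there are many edges inside [R], each costing at least [1]. *)
Lemma heavy_boundary_cost (a b : nat) (c : T -> T -> nat) (R : {set T}) :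
  (forall x, a <= deg h x) -> 1 < b -> R != set0 -> R != setT ->
  (forall x y, c x y = c y x) ->
  (forall x y, x \in R -> 0 < c x y) ->
  (forall x y, x \in R -> y \notin R -> b * b <= c x y) ->
  2 * (a * b) < \sum_x \sum_y h x y * c x y.
Proof.
move=> a_min b1 /set0Pn[x0 x0R] Rproper c_sym c1 cb.
pose E := \sum_(x in R) \sum_(y in R) h x y.
pose D := \sum_(x in R) \sum_(y | y \notin R) h x y.
(* Boundary edges occur in both orders, hence the factor 2; pairs outside [R] are dropped. *)
have cost : E + 2 * (b * b * D) <= \sum_x \sum_y h x y * c x y.
  rewrite (bigID (mem R)) /= mul2n -addnn addnA; apply: leq_add.
    rewrite -[X in _ + X]mulnC /E /D big_distrl -big_split /=.
    apply: leq_sum => x xR; rewrite [leqRHS](bigID (mem R)) /=.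
    apply: leq_add; last rewrite big_distrl /=; apply: leq_sum => y yR.
      by rewrite -{1}[nat_of_bool _]muln1 leq_mul2l c1 ?orbT.
    by rewrite leq_mul2l cb ?orbT.
  rewrite mulnC /D exchange_big big_distrl /=; apply: leq_sum => x xR.
  rewrite [leqRHS](bigID (mem R)) /= big_distrl /=.
  apply: leq_trans (leq_addr _ _); apply: leq_sum => y yR.
  by rewrite h_sym leq_mul2l c_sym cb ?orbT.
have ED : #|R| * a <= E + D.
  rewrite -sum_nat_const -big_split /=; apply: leq_sum => x xR.
  by apply: (leq_trans (a_min x)); rewrite /deg (bigID (mem R)).
have ER : E <= #|R| * #|R|.-1.
  rewrite -sum_nat_const; apply: leq_sum => x xR.
  rewrite (bigD1 x) //= h_irr add0n (cardsD1 x R) xR /= -sum1_card.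
  rewrite [leqRHS](eq_bigl (fun y => (y \in R) && (y != x))) => [|y]; last first.
    by rewrite !inE andbC.
  by apply: leq_sum => y _; case: (h x y).
have D0 : 0 < D.
  rewrite lt0n; apply: contra Rproper => /eqP D0; apply/eqP/setP => y.
  rewrite inE; apply: (closed_full x0R) => {}y z yR hyz.
  apply/negPn/negP => zR; have /eqP := D0.
  by rewrite /D (bigD1 y) //= (bigD1 z) //= hyz.
have R0 : 0 < #|R| by rewrite card_gt0; apply/set0Pn; exists x0.
move: E D #|R| {c1 cb c_sym a_min} ED ER D0 R0 cost => E D r ED ER D0 r0.
apply: leq_trans; have [ra|ra] := ltnP a r.
  (* Here E + D >= a^2 + a, and the remaining (2b^2 - 1)D is at least 2b^2 - 1, so the total exceeds
     a^2 + b^2. *)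
  have AG : 2 * (a * b) <= a * a + b * b.
    by have [+ _] := nat_Cauchy a b; rewrite -!mulnn.
  have bb : 4 <= b * b by nia.
  have ra2 : a * a + a <= r * a by nia.
  have bD : b * b + D <= b * b * D + 1 by nia.
  have : b * b <= b * b * D by nia.
  lia.
(* D >= ra - r(r-1) = r(a+1-r) >= a, because 1 <= r <= a. *)
have aD : a <= D by nia.
have : 2 * (b * a) <= b * b * a by nia.
have : b * b * a <= b * b * D by rewrite leq_mul2l aD orbT.
have : 0 < a * b by nia.
lia.
Qed.

End ConnectedGraph.

(** * Colorings of the product *)

(** The pairs [x], [x'] are ordered, so every cut edge counts twice; hence the budget [2 * (a * b)]
    below. *)
Definition coloring_cost (T1 T2 : finType) (g : rel T1) (h : rel T2)
    (M : T1 -> T2 -> bool) : nat :=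
  \sum_x \sum_x' g x x' * row_cut h (M x) (M x').

(** At most two distinct rows, encoded by the set of vertices that carry one of them. *)
Definition two_rows (T1 T2 : finType) (M : T1 -> T2 -> bool) : Prop :=
  exists X : {set T1}, forall x x' y, (x \in X) = (x' \in X) -> M x y = M x' y.

Definition transpose (T1 T2 : finType) (M : T1 -> T2 -> bool) y x := M x y.

Lemma coloring_cost_transpose (T1 T2 : finType) (g : rel T1) (h : rel T2) M :
  coloring_cost h g (transpose M) = coloring_cost g h M.
Proof.
have expand (U1 U2 : finType) (e1 : rel U1) (e2 : rel U2) N : coloring_cost e1 e2 N =
    \sum_x \sum_x' \sum_y \sum_y' e1 x x' * (e2 y y' * (N x y (+) N x' y')).
  apply: eq_bigr => x _; apply: eq_bigr => x' _; rewrite big_distrr.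
  by apply: eq_bigr => y _; rewrite big_distrr.
rewrite !expand; under eq_bigr => y _ do rewrite exchange_big.
rewrite exchange_big /=; apply: eq_bigr => x _.
under eq_bigr => y _ do rewrite exchange_big.
rewrite exchange_big /=; apply: eq_bigr => x' _.
by apply: eq_bigr => y _; apply: eq_bigr => y' _; rewrite mulnCA.
Qed.

Lemma two_rows_card (T1 T2 : finType) (M : T1 -> T2 -> bool) :
  #|T1| <= 2 -> two_rows M.
Proof.
move=> le2; case: (pickP (@predT T1)) => [x0 _|none]; last first.
  by exists set0 => x; have := none x.
exists [set x0] => x x' y; rewrite !inE => e; congr (M _ y).
have [xx|xx0] := eqVneq x x0; first by move: e; rewrite xx eqxx => /esym/eqP->.
have [//|xx'] := eqVneq x x'.
have : #|[set x0; x; x']| <= 2 by apply: leq_trans le2; apply: max_card.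
rewrite -setUA !cardsU1 !inE cards1 xx' -(eq_sym x) (negbTE xx0).
by rewrite (eq_sym x0) -e (negbTE xx0).
Qed.

(** For bits, u xor v = u + v - 2uv; the correction stands on the left to avoid truncated
    subtraction. *)
Lemma row_cut_parity (T : finType) (h : rel T) (f f' : T -> bool) :
  symmetric h ->
  row_cut h f f' + 2 * (\sum_y \sum_z h y z * (f y && f' z)) =
  \sum_y deg h y * f y + \sum_y deg h y * f' y.
Proof.
move=> h_sym.
have -> : \sum_y deg h y * f' y = \sum_y \sum_z h y z * f' z.
  rewrite exchange_big; apply: eq_bigr => y _; rewrite /deg big_distrl /=.
  by apply: eq_bigr => z _; rewrite h_sym.
rewrite /row_cut big_distrr -!big_split /=; apply: eq_bigr => y _.
rewrite /deg big_distrl big_distrr -!big_split /=; apply: eq_bigr => z _.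
by case: (h y z) (f y) (f' z) => [] [] [].
Qed.

(** Used whenever an exhausted budget leaves no slack in termwise bounds. *)
Lemma eq_from_leq_sum (I : finType) (E1 E2 : I -> nat) :
  (forall i, E1 i <= E2 i) -> \sum_i E2 i <= \sum_i E1 i -> E1 =1 E2.
Proof.
move=> le12 le21 i.
have [le eqf] := leqif_sum (fun i (_ : predT i) => leqif_eq (le12 i)).
have : \sum_i E1 i == \sum_i E2 i by rewrite eqn_leq le le21.
by rewrite eqf => /forallP/(_ i)/eqP.
Qed.

Section Coloring.
Variables (T1 T2 : finType) (g : rel T1) (h : rel T2).
Hypotheses (g_sym : symmetric g) (h_sym : symmetric h).
Hypothesis g_irr : irreflexive g.
Hypotheses (g_conn : forall x y, connect g x y).
Hypotheses (h_conn : forall x y, connect h x y).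
Variables a b : nat.
Hypothesis b0 : 0 < b.
Hypotheses (a_min : forall x, a <= deg g x) (b_min : forall y, b <= deg h y).
Variable M : T1 -> T2 -> bool.
Hypothesis cheap : coloring_cost g h M <= 2 * (a * b).

(** Good rows are constant on the classes generated by [k], the relation of having a common
    neighbor. In a connected graph a vertex [y0] and a neighbor [y1] represent all classes. *)
Lemma two_cols_of_good :
  (forall x, minority h (M x) = 0) -> two_rows (transpose M).
Proof.
move=> good; pose k := [rel y z | [exists w, h w y && h w z]].
case: (pickP (@predT T2)) => [y0 _|none]; last first.
  by exists set0 => y; have := none y.
have Mk x y z : connect k y z -> M x y = M x z.
  case/connectP=> p + ->; elim: p y => //= y' p IH y /andP[/existsP[w /andP[h1 h2]] /IH <-].
  by have /minority0P mono := good x; apply: (mono w).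
have k_sym : connect_sym k.
  apply: sym_connect_sym => y z; apply/existsP/existsP => -[w /andP[h1 h2]];
  by exists w; rewrite h1 h2.
have [y1 hy1] := deg_pos_neighbour (leq_trans b0 (b_min y0)).
have cover y : y \in [set y | connect k y0 y || connect k y1 y].
  apply: (@closed_full _ h h_sym h_conn _ y0); first by rewrite inE connect0.
  move=> u v; rewrite !inE => H huv.
  (* A [k]-path stays a [k]-path when shifted along an edge at each end: the midpoints of its steps
     take the place of its vertices. *)
  have step w w' z : connect k w z -> h w w' -> h z v -> connect k w' v.
    case/connectP=> p + ->; elim: p w w' => [|s p IH] w w' /=.
      by move=> _ hw hv; apply: connect1; apply/existsP; exists w; rewrite hw.
    case/andP=> /existsP[t /andP[hw hu]] pth hww' hv.
    apply: (@connect_trans _ _ t); last by apply: (IH s); rewrite // h_sym.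
    apply: connect1; apply/existsP; exists w; rewrite hww' /=.
    by rewrite h_sym.
  case/orP: H => H.
    by rewrite (step y0 y1 u) ?orbT.
  by rewrite (step y1 y0 u) // h_sym.
exists [set y | connect k y0 y] => y y' x; rewrite !inE /transpose => e.
apply: Mk; case c0: (connect k y0 y).
  by apply: (@connect_trans _ _ y0); rewrite ?(k_sym y) -?e.
have := cover y; have := cover y'; rewrite !inE -e c0 /= => c1 c2.
by apply: connect_trans c1; rewrite k_sym.
Qed.

(** If the set of bad rows were proper, its edges to good rows, costing at least b^2 each, and its
    inner edges, costing at least 1 each, would exceed the budget by [heavy_boundary_cost]. *)
Lemma all_rows_bad :
  (forall x, minority h (M x) < b) -> (exists x, 0 < minority h (M x)) ->
  forall x, 0 < minority h (M x).
Proof.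
move=> small [x0 bad0]; pose R := [set x | 0 < minority h (M x)].
suff /eqP RT : R == setT by move=> x; have : x \in R; [rewrite RT|rewrite inE].
apply: contraLR cheap => RT; rewrite -ltnNge.
apply: (heavy_boundary_cost g_sym g_irr g_conn (R := R) (b := b)) => //.
- exact: leq_trans (small x0).
- by apply/set0Pn; exists x0; rewrite inE.
- by move=> x y; apply: row_cutC.
- move=> x y; rewrite inE row_cutC // => bx.
  by apply: leq_trans bx _; apply: minority_le_row_cut.
- move=> x y; rewrite !inE -eqn0Ngt => bx /eqP gy.
  by apply: row_cut_bad_good => //; rewrite bx small.
Qed.

End Coloring.

(** Every edge of either factor costs at least 1, so |G|a and |H|b are at most 2ab; color counts in
    one column and one row give 2a <= |G| and 2b <= |H|. Hence 2a <= |G| <= 2b <= |H| <= 2a, and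
    every estimate is tight. *)
Lemma no_all_bad_coloring (T1 T2 : finType) (g : rel T1) (h : rel T2)
    (a b : nat) (M : T1 -> T2 -> bool) :
  symmetric g -> symmetric h -> 0 < a -> 0 < b ->
  (forall x, a <= deg g x) -> (forall y, b <= deg h y) ->
  (exists x : T1, True) ->
  coloring_cost g h M <= 2 * (a * b) ->
  (forall x, 0 < minority h (M x) < b) ->
  (forall y, 0 < minority g (transpose M y) < a) -> False.
Proof.
move=> g_sym h_sym a0 b0 a_min b_min [x0 _] cheap bad_row bad_col.
have y0 : exists y0 : T2, True.
  have /andP[+ _] := bad_row x0; rewrite /minority.
  case: (pickP (@predT T2)) => [y _ _|none]; first by exists y.
  by rewrite big1 // => y; have := none y.
case: y0 => y0 _.
have sum_ge (T : finType) (e : rel T) d : (forall x, d <= deg e x) ->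
    #|T| * d <= \sum_x deg e x.
  by move=> dm; rewrite -sum_nat_const; apply: leq_sum => x _.
have cost_ge (U1 U2 : finType) (e1 : rel U1) (e2 : rel U2) N d :
    symmetric e2 -> (forall x, 0 < minority e2 (N x) < d) ->
    \sum_x deg e1 x <= coloring_cost e1 e2 N.
  move=> s2 bad; apply: leq_sum => x _; apply: leq_sum => x' _.
  rewrite leq_pmulr //; have /andP[t0 _] := bad x'.
  by apply: leq_trans t0 _; apply: minority_le_row_cut.
have gK := cost_ge _ _ g h M b h_sym bad_row.
have hK := cost_ge _ _ h g (transpose M) a g_sym bad_col.
rewrite coloring_cost_transpose in hK.
have g1 := sum_ge _ g a a_min; have h1 := sum_ge _ h b b_min.
have g2 := minority_small_card g_sym a_min (bad_col y0).
have h2 := minority_small_card h_sym b_min (bad_row x0).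
have G2b : #|T1| <= 2 * b.
  rewrite -(leq_pmul2r a0) -mulnA (mulnC b); apply: leq_trans g1 _.
  exact: leq_trans gK cheap.
have H2a : #|T2| <= 2 * a.
  rewrite -(leq_pmul2r b0) -mulnA; apply: leq_trans h1 _.
  exact: leq_trans hK cheap.
have ab : a = b by lia.
subst b; have cG : #|T1| = 2 * a by lia.
have cH : #|T2| = 2 * a by lia.
rewrite cG in g1; rewrite cH in h1; rewrite mulnA in cheap.
have degh y : deg h y = a.
  apply/esym; apply: (eq_from_leq_sum (E1 := fun=> a) (E2 := deg h)) => //.
  by rewrite sum_nat_const cH -mulnA; apply: leq_trans hK _; rewrite mulnA.
(* Each color occurs at least [a] times among [2 * a] vertices. *)
have half x : \sum_y M x y = a.
  have p := minority_small_count h_sym b_min (bad_row x).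
  have badn : 0 < minority h (fun y => ~~ M x y) < a.
    by rewrite minority_neg.
  have q := minority_small_count h_sym b_min badn.
  have : \sum_y M x y + \sum_y ~~ M x y = 2 * a.
    rewrite -cH -sum1_card -big_split /=; apply: eq_bigr => y _.
    by case: (M x y).
  lia.
have [x1 gx] := deg_pos_neighbour (leq_trans a0 (a_min x0)).
have c_pos x x' : 0 < row_cut h (M x) (M x').
  have /andP[t0 _] := bad_row x'.
  by apply: leq_trans t0 _; apply: minority_le_row_cut.
(* The cost is no larger than the degree sum of G, so each edge of G carries exactly one cut
   edge. *)
have c1 : row_cut h (M x0) (M x1) = 1.
  have le x x' : g x x' <= g x x' * row_cut h (M x) (M x') by rewrite leq_pmulr.
  have eq0 : deg g x0 = \sum_x' g x0 x' * row_cut h (M x0) (M x').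
    apply: (eq_from_leq_sum (E1 := deg g)
      (E2 := fun x => \sum_x' g x x' * row_cut h (M x) (M x'))).
      by move=> x; apply: leq_sum.
    exact: leq_trans cheap g1.
  have := eq_from_leq_sum (le x0) _ x1; rewrite gx mul1n => <- //.
  by rewrite -eq0.
(* The left side is 1 plus an even number, the right side is a^2 + a^2. *)
have := row_cut_parity (M x0) (M x1) h_sym; rewrite c1.
have e x : \sum_y deg h y * M x y = a * a.
  under eq_bigr do rewrite degh.
  by rewrite -big_distrr half.
rewrite !e => /(congr1 odd); rewrite oddD oddM /= addnn odd_double //.
Qed.

(** * Rows of large minority *)

Definition flip (T1 T2 : finType) (M : T1 -> T2 -> bool) x0 y0 x y :=
  M x y (+) ((x == x0) && (y == y0)).

(** Both colors occur, which is what makes a coloring define an edge-cut. *)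
Definition nonconstant (T1 T2 : finType) (M : T1 -> T2 -> bool) : Prop :=
  exists x x' y y', M x y != M x' y'.

Lemma eq_row_cut (T : finType) (h : rel T) f1 f2 f1' f2' :
  f1 =1 f2 -> f1' =1 f2' -> row_cut h f1 f1' = row_cut h f2 f2'.
Proof.
by move=> e e'; apply: eq_bigr => y _; apply: eq_bigr => z _; rewrite e e'.
Qed.

Lemma eq_minority (T : finType) (h : rel T) f1 f2 :
  f1 =1 f2 -> minority h f1 = minority h f2.
Proof.
by move=> e; apply: eq_bigr => y _; congr minn; apply: eq_bigr => z _; rewrite e.
Qed.

(* A row of minority at least [b] already accounts for the whole budget, so
   all cut edges are at this row and it differs from the row expected by each
   neighbour in one vertex.  If that vertex is always the same, flipping it
   gives a coloring of cost [0]; otherwise two such vertices are twins of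
   minimum degree. *)
Lemma heavy_row (T1 T2 : finType) (g : rel T1) (h : rel T2) (a b : nat)
    (M : T1 -> T2 -> bool) x0 :
  symmetric g -> irreflexive g -> (forall x y, connect g x y) ->
  symmetric h -> irreflexive h -> (forall x y, connect h x y) ->
  0 < a -> 0 < b -> (forall x, a <= deg g x) -> (forall y, b <= deg h y) ->
  coloring_cost g h M <= 2 * (a * b) ->
  (forall N, nonconstant N -> coloring_cost g h M <= coloring_cost g h N) ->
  ~ graph_iso h P3_rel -> ~ graph_iso h C4_rel ->
  b <= minority h (M x0) -> two_rows M \/ two_rows (transpose M).
Proof.
move=> g_sym g_irr g_conn h_sym h_irr h_conn a0 b0 a_min b_min cheap minM.
move=> nP3 nC4 heavy.
pose E x x' := g x x' * row_cut h (M x) (M x').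
pose s := \sum_x' E x0 x'.
pose rest := \sum_(x | x != x0) \sum_(x' | x' != x0) E x x'.
have E_sym x x' : E x x' = E x' x by rewrite /E g_sym row_cutC.
have split_cost : coloring_cost g h M = 2 * s + rest.
  rewrite /coloring_cost (bigD1 x0) //= mul2n -addnn -addnA; congr (_ + _).
  under eq_bigr => x _ do rewrite (bigD1 x0) //=.
  rewrite big_split /=; congr (_ + _).
  rewrite /s [RHS](bigD1 x0) //= {1}/E g_irr add0n.
  by apply: eq_bigr => x _; apply: E_sym.
have le_s x : g x0 x * b <= E x0 x.
  rewrite /E leq_mul2l; apply/orP; right; rewrite row_cutC //.
  by apply: leq_trans heavy _; apply: minority_le_row_cut.
have deg_s : deg g x0 * b <= s by rewrite /deg big_distrl /=; apply: leq_sum.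
have ab_s : a * b <= deg g x0 * b by rewrite leq_mul2r a_min orbT.
have s0 : 0 < s by apply: leq_trans deg_s; apply: leq_trans ab_s; rewrite muln_gt0 a0.
(* The budget is spent at [x0]: no edge of G away from [x0] carries a cut edge, [x0] has degree [a],
   and each edge at [x0] carries exactly [b]. *)
have rest0 : rest = 0 by lia.
have s_le : s <= deg g x0 * b by lia.
have deg_x0 : deg g x0 = a.
  have : deg g x0 * b <= a * b by lia.
  by rewrite leq_pmul2r // => le; apply/eqP; rewrite eqn_leq le a_min.
have cut0 x x' : x != x0 -> x' != x0 -> g x x' -> row_cut h (M x) (M x') = 0.
  move=> xx0 xx0' gx; apply/eqP; move/eqP: rest0; rewrite sum_nat_eq0.
  move/forall_inP/(_ x xx0); rewrite sum_nat_eq0 => /forall_inP/(_ x' xx0').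
  by rewrite /E gx mul1n.
have cutb x : g x0 x -> row_cut h (M x0) (M x) = b.
  move=> gx; have := eq_from_leq_sum le_s _ x; rewrite /E gx !mul1n => -> //.
  by rewrite -big_distrl.
case: (pickP [pred x | (x != x0) && (minority h (M x) != 0)]) => [x1|good'].
  (* A bad row [x1] other than [x0] has [x0] as its only neighbor, since any other edge at it would
     carry a cut edge. Then a = 1 and G is K_2. *)
  case/andP=> x10 bad1; left; apply: two_rows_card.
  have N1 x : g x1 x -> x = x0.
    move=> gx; apply/eqP; apply: contraR bad1 => xx0; rewrite -leqn0.
    by rewrite -(cut0 x x1) ?minority_le_row_cut // g_sym.
  have [x gx] := deg_pos_neighbour (leq_trans a0 (a_min x1)).
  have g10 : g x1 x0 by rewrite -(N1 x gx).
  have a1 : a <= 1.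
    apply: leq_trans (a_min x1) _; rewrite degE -(cards1 x0).
    by apply/subset_leq_card/subsetP => z; rewrite !inE => /N1->.
  have /cards1P[z Nz] : #|[set z | g x0 z]| == 1.
    by rewrite -degE deg_x0 eqn_leq a1.
  have N0 x' : g x0 x' -> x' = x1.
    have : x1 \in [set z | g x0 z] by rewrite inE g_sym.
    rewrite Nz inE => /eqP-> gx'.
    have : x' \in [set z | g x0 z] by rewrite inE.
    by rewrite Nz inE => /eqP.
  have full : forall y, y \in [set x0; x1].
    apply: (@closed_full _ g g_sym g_conn _ x0); first by rewrite !inE eqxx.
    move=> u v; rewrite !inE => /orP[]/eqP->.
      by move/N0->; rewrite eqxx orbT.
    by move/N1->; rewrite eqxx.
  rewrite -cardsT; apply: leq_trans (subset_leq_card (B := [set x0; x1]) _) _.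
    by apply/subsetP => y _; apply: full.
  by rewrite cards2; case: eqP.
have good x : x != x0 -> minority h (M x) = 0.
  by move=> xx0; have := good' x; rewrite /= xx0 /= => /negbFE/eqP.
have nbr_neq x : g x0 x -> x != x0 by apply: contraTneq => ->; rewrite g_irr.
(* The row cut is [b] and each deviation from the expected row costs at least [b], so there is a
   single deviation, at a vertex of degree [b]. *)
have exc x : g x0 x -> exists2 y', deg h y' = b &
    forall y, M x0 y (+) expected h (M x) y = (y == y').
  move=> gx; have := cutb x gx; rewrite row_cut_expected ?good ?nbr_neq //.
  case: (pickP [pred y | M x0 y (+) expected h (M x) y]) => [y /= dy|none]; last first.
    rewrite big1 => [e0|y _]; first by rewrite -e0 in b0.
    by have /= -> := none y; rewrite muln0.
  rewrite (bigD1 y) //= dy muln1 => eqb; have bmy := b_min y.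
  exists y; first by lia.
  move=> z; have [->//|zy] := eqVneq z y; apply/negbTE.
  have : \sum_(i | i != y) deg h i * (M x0 i (+) expected h (M x) i) = 0 by lia.
  move/eqP; rewrite sum_nat_eq0 => /forall_inP/(_ z zy).
  rewrite muln_eq0 eqb0 => /orP[/eqP dz|//].
  by have := b_min z; rewrite dz; lia.
have [x1 gx1] := deg_pos_neighbour (leq_trans a0 (a_min x0)).
have [y1 deg1 exc1] := exc x1 gx1.
case: (pickP [pred x | g x0 x &
    ~~ [forall y, M x0 y (+) expected h (M x) y == (y == y1)]]) => [x2|same].
  case/andP=> gx2 /forallPn[y nexc2].
  have [y2 deg2 exc2] := exc x2 gx2.
  have y12 : y1 != y2 by apply: contraNneq nexc2 => ->; rewrite exc2.
  (* The two expected rows are good and differ exactly at [y1] and [y2]. *)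
  have pair0 : minority h (fun y => (y == y1) || (y == y2)) = 0.
    have := @minority_addb _ h (expected h (M x1)) (expected h (M x2)).
    rewrite !minority_expected ?good ?nbr_neq // => /(_ erefl) <-.
    apply: eq_minority => z; have := exc1 z; have := exc2 z.
    have : ~~ ((z == y1) && (z == y2)).
      by apply: contra y12 => /andP[/eqP<- /eqP<-].
    by case: (z == y1) (z == y2) (M x0 z) (expected h (M x1) z) (expected h (M x2) z)
      => [] [] [] [] [].
  case: (twin_pair_graph h_sym h_irr h_conn b_min y12 deg1 deg2 pair0) => //.
  by move=> le2; right; apply: two_rows_card.
(* Now all neighbors of [x0] share the deviation [y1], and flipping it removes every cut edge. *)
pose N := flip M x0 y1.
have N_other x : x != x0 -> N x =1 M x.
  by move=> xx0 y; rewrite /N /flip (negbTE xx0) addbF.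
have N_x0 x : g x0 x -> N x0 =1 expected h (M x).
  move=> gx y; have := same x; rewrite /= gx /= => /negbFE/forallP/(_ y)/eqP.
  by rewrite /N /flip eqxx /= => <-; rewrite addbA addbb.
have cutN0 x : g x0 x -> row_cut h (N x0) (N x) = 0.
  move=> gx; rewrite (eq_row_cut h (N_x0 x gx) (N_other _ (nbr_neq x gx))).
  rewrite row_cut_expected ?good ?nbr_neq // big1 // => y _.
  by rewrite addbb muln0.
have costN : coloring_cost g h N = 0.
  apply: big1 => x _; apply: big1 => x' _; case gx: (g x x') => //.
  rewrite mul1n; have [xx0|xx0] := eqVneq x x0; first by rewrite xx0 cutN0 // -xx0.
  have [xx0'|xx0'] := eqVneq x' x0.
    by rewrite row_cutC // xx0' cutN0 // -xx0' g_sym.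
  by rewrite (eq_row_cut h (N_other _ xx0) (N_other _ xx0')) cut0.
left; exists [set x0] => x x' y; rewrite !inE => exx'.
have : N x y == N x' y.
  (* A nonconstant [N] of cost 0 would beat [M], whose cost is at least [2 * s] > 0. *)
  apply: contraT => neq; have := minM N; rewrite costN split_cost => le0.
  suff: 2 * s + rest <= 0 by lia.
  by apply: le0; exists x, x', y, y.
rewrite /N /flip exx'; by case: (_ && _) (M x y) (M x' y) => [] [] [].
Qed.

(** * Colorings of minimum cost *)

Lemma min_degree (T : finType) (h : rel T) (y0 : T) :
  exists d y1, deg h y1 = d /\ forall y, d <= deg h y.
Proof.
case: (arg_minnP (deg h) (erefl (predT y0))) => y1 _ min.
by exists (deg h y1), y1; split=> // y; apply: min.
Qed.

(** This is the cut that isolates one vertex; at vertices of minimum degree it supplies the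
    budget. *)
Lemma singleton_cost (T1 T2 : finType) (g : rel T1) (h : rel T2) x0 y0 :
  symmetric g -> symmetric h ->
  coloring_cost g h (fun x y => (x == x0) && (y == y0)) <=
  2 * (deg g x0 * deg h y0).
Proof.
move=> g_sym h_sym; pose N x y := (x == x0) && (y == y0).
have row x : \sum_y deg h y * N x y = (x == x0) * deg h y0.
  rewrite (bigD1 y0) //= {1}/N eqxx andbT mulnC big1 ?addn0 // => y yy0.
  by rewrite /N (negbTE yy0) andbF muln0.
apply: (@leq_trans (\sum_x \sum_x'
    (g x x' * ((x == x0) * deg h y0) + g x x' * ((x' == x0) * deg h y0)))).
  apply: leq_sum => x _; apply: leq_sum => x' _; rewrite -mulnDr leq_mul2l.
  by rewrite -!row -(row_cut_parity (N x) (N x') h_sym) leq_addr orbT.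
have half : \sum_x \sum_x' g x x' * ((x == x0) * deg h y0) = deg g x0 * deg h y0.
  rewrite (bigD1 x0) //= [X in _ + X]big1 => [|x xx0]; last first.
    by rewrite big1 // => x' _; rewrite (negbTE xx0) mul0n muln0.
  by rewrite addn0 eqxx mul1n -big_distrl.
under eq_bigr => x _ do rewrite big_split.
rewrite big_split /= half mul2n -addnn leq_add2l exchange_big.
under eq_bigr => x _ do under eq_bigr => x' _ do rewrite g_sym.
by rewrite half.
Qed.

(** The theorem for connected factors with colorings in place of edge sets: minimality is among all
    nonconstant colorings. *)
Lemma minimal_coloring (T1 T2 : finType) (g : rel T1) (h : rel T2)
    (M : T1 -> T2 -> bool) :
  symmetric g -> irreflexive g -> (forall x y, connect g x y) ->
  symmetric h -> irreflexive h -> (forall x y, connect h x y) ->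
  ~ graph_iso g P3_rel -> ~ graph_iso g C4_rel ->
  ~ graph_iso h P3_rel -> ~ graph_iso h C4_rel ->
  nonconstant M ->
  (forall N, nonconstant N -> coloring_cost g h M <= coloring_cost g h N) ->
  two_rows M \/ two_rows (transpose M).
Proof.
move=> g_sym g_irr g_conn h_sym h_irr h_conn gP3 gC4 hP3 hC4 [x0 [_ [y0 _]]] minM.
(* At most two vertices means at most two rows or columns. Larger connected factors have positive
   minimum degrees. *)
have [small1|big1] := leqP #|T1| 2; first by left; apply: two_rows_card.
have [small2|big2] := leqP #|T2| 2; first by right; apply: two_rows_card.
have other (T : finType) (x : T) : 2 < #|T| -> exists y, x != y.
  move=> big; case: (pickP [pred y | x != y]) => [y|none]; first by exists y.
  have : #|T| <= #|[set x]|; last by rewrite cards1 leqNgt (ltn_trans _ big).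
  rewrite -cardsT; apply/subset_leq_card/subsetP => y _.
  by have := none y; rewrite /= !inE eq_sym => /negbFE.
have deg_pos (T : finType) (e : rel T) x :
    (forall x y, connect e x y) -> 2 < #|T| -> 0 < deg e x.
  move=> conn big; have [y xy] := other _ x big.
  have [z xz] := connected_neighbour conn xy.
  by rewrite /deg (bigD1 z) //= xz.
have [a [x1 [degx a_min]]] := min_degree g x0.
have [b [y1 [degy b_min]]] := min_degree h y0.
have a0 : 0 < a by rewrite -degx deg_pos.
have b0 : 0 < b by rewrite -degy deg_pos.
have cheap : coloring_cost g h M <= 2 * (a * b).
  rewrite -degx -degy; apply: leq_trans (singleton_cost x1 y1 g_sym h_sym).
  have [x2 x12] := other _ x1 big1; apply: minM; exists x1, x2, y1, y1.
  by rewrite !eqxx (eq_sym x2) (negbTE x12).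
have cheapT : coloring_cost h g (transpose M) <= 2 * (b * a).
  by rewrite coloring_cost_transpose (mulnC b).
have [/existsP[x heavy]|light] := boolP [exists x, b <= minority h (M x)].
  exact: (heavy_row g_sym g_irr g_conn h_sym h_irr h_conn a0 b0 a_min b_min
            cheap minM hP3 hC4 heavy).
have [/existsP[y heavy]|lightT] := boolP [exists y, a <= minority g (transpose M y)].
  have minMT N : nonconstant N ->
      coloring_cost h g (transpose M) <= coloring_cost h g N.
    move=> [y2 [y3 [x2 [x3 ne]]]].
    rewrite coloring_cost_transpose -(coloring_cost_transpose h g N).
    by apply: minM; exists x2, x3, y2, y3.
  by case: (heavy_row h_sym h_irr h_conn g_sym g_irr g_conn b0 a0 b_min a_min
            cheapT minMT gP3 gC4 heavy); [right|left].
have {}light x : minority h (M x) < b.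
  by rewrite ltnNge; move: light; rewrite negb_exists => /forallP/(_ x).
have {}lightT y : minority g (transpose M y) < a.
  by rewrite ltnNge; move: lightT; rewrite negb_exists => /forallP/(_ y).
case: (pickP [pred x | 0 < minority h (M x)]) => [x bad|good]; last first.
  right; apply: (two_cols_of_good h_sym h_conn b0 b_min) => x.
  by have /negbT := good x; rewrite -eqn0Ngt => /eqP.
case: (pickP [pred y | 0 < minority g (transpose M y)]) => [y badT|good]; last first.
  left; apply: (two_cols_of_good g_sym g_conn a0 a_min (M := transpose M)) => y.
  by have /negbT := good y; rewrite -eqn0Ngt => /eqP.
(* A bad row and a bad column are left, and these force all rows and all columns to be bad. *)
case: (no_all_bad_coloring g_sym h_sym a0 b0 a_min b_min (ex_intro _ x0 I) cheap).
  move=> x'; rewrite light andbT.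
  by apply: (all_rows_bad g_sym h_sym g_irr g_conn a_min b_min cheap light); exists x.
move=> y'; rewrite lightT andbT.
by apply: (all_rows_bad h_sym g_sym h_irr h_conn b_min a_min cheapT lightT); exists y.
Qed.

(** * Edge-cuts and components *)

Definition cutset (V : finType) (e : rel V) (A : {set V}) : {set {set V}} :=
  [set [set p.1; p.2] | p in [set p | [&& e p.1 p.2, p.1 \in A & p.2 \notin A]]].

(** Orienting each edge from [A] to its complement makes the map from pairs to edges injective; the
    sum counts both orientations. *)
Lemma card_cutset (V : finType) (e : rel V) (A : {set V}) : symmetric e ->
  2 * #|cutset e A| = \sum_u \sum_v e u v * ((u \in A) (+) (v \in A)).
Proof.
move=> e_sym; rewrite /cutset card_in_imset => [|[u v] [u' v']]; last first.
  rewrite !inE /= => /and3P[_ uA vA] /and3P[_ uA' vA'] uv.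
  have neq w w' : w \in A -> w' \notin A -> (w == w') = false.
    by move=> wA; apply: contraNF => /eqP<-.
  have : u \in [set u'; v'] by rewrite -uv !inE eqxx.
  have : v \in [set u'; v'] by rewrite -uv !inE eqxx orbT.
  rewrite !inE (eq_sym v u') (neq u' v) // (neq u v') // orbF.
  by move=> /eqP-> /eqP->.
have -> : #|[set p | [&& e p.1 p.2, p.1 \in A & p.2 \notin A]]| =
    \sum_u \sum_v e u v * ((u \in A) && (v \notin A)).
  rewrite pair_bigA -sum1dep_card big_mkcond; apply: eq_bigr => -[u v] _ /=.
  by case: (e u v) => //=; rewrite mul1n; case: (_ && _).
rewrite mul2n -addnn [X in _ + X]exchange_big -big_split; apply: eq_bigr => u _.
rewrite -big_split; apply: eq_bigr => v _ /=; rewrite (e_sym v).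
by case: (e u v) (u \in A) (v \in A) => [] [] [].
Qed.

Lemma edge_cut_cutset (V : finType) (e : rel V) (A : {set V}) u v :
  symmetric e -> u \in A -> v \notin A -> edge_cut e (cutset e A).
Proof.
move=> e_sym uA vA; split.
  move=> s /imsetP[[x y]]; rewrite inE /= => /and3P[exy _ _] ->.
  by exists x, y.
exists u, v; apply: contra vA => uv.
have cl : closed (del_edges e (cutset e A)) A.
  move=> x y /andP[exy]; apply: contraNeq => neq.
  have [xA|xA] := boolP (x \in A).
    apply/imsetP; exists (x, y); rewrite // inE /= exy xA /=.
    by move: neq; rewrite xA; case: (y \in A).
  apply/imsetP; exists (y, x); last by rewrite setUC.
  by move: neq; rewrite inE /= e_sym exy xA (negbTE xA); case: (y \in A).
by rewrite -(closed_connect cl uv).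
Qed.

(** For [pr] a projection to a factor: [B] and [W] each project into one connected class of [g]. The
    classes of [pr u] and [pr v] differ, so one belongs to [B] and the other to [W]. *)
Lemma component_fibres (V T : finType) (e : rel V) (g : rel T) (pr : V -> T)
    (B W : {set V}) u v :
  symmetric g -> (forall p q, e p q -> g (pr p) (pr q)) ->
  is_component e B -> is_component e W -> B :|: W = setT ->
  ~~ connect g (pr u) (pr v) ->
  exists X : {set T}, B = [set p | pr p \in X] /\ W = [set p | pr p \notin X].
Proof.
move=> g_sym pr_hom [_ cB] [_ cW] /setP cover nuv.
have same p q : connect e p q -> connect g (pr p) (pr q).
  case/connectP=> s + ->; elim: s p => //= r s IH p /andP[epr /IH].
  by apply: connect_trans; apply/connect1/pr_hom.
have cov p : (p \in B) || (p \in W) by have := cover p; rewrite !inE.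
have gC := sym_connect_sym g_sym.
have neq p : connect g (pr u) (pr p) -> connect g (pr v) (pr p) -> false.
  move=> up vp; move: nuv; rewrite (connect_trans up) // gC //.
have inB p q : p \in B -> q \in B -> connect g (pr p) (pr q).
  by move=> pB qB; apply: same; rewrite (cB p pB).
have inW p q : p \in W -> q \in W -> connect g (pr p) (pr q).
  by move=> pW qW; apply: same; rewrite (cW p pW).
(* Stated for an arbitrary pair, to serve both the case of [u] in [B] and that of [u] in [W]. *)
have by_reach u' v' (B' W' : {set V}) : (forall p, connect g (pr u') (pr p) ->
      connect g (pr v') (pr p) -> false) ->
    (forall p, (p \in B') || (p \in W')) ->
    (forall p q, p \in B' -> q \in B' -> connect g (pr p) (pr q)) ->
    (forall p q, p \in W' -> q \in W' -> connect g (pr p) (pr q)) ->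
    u' \in B' -> v' \in W' ->
    forall p, (p \in B') = connect g (pr u') (pr p) /\
              (p \in W') = ~~ connect g (pr u') (pr p).
  move=> neq' cov' inB' inW' uB vW p.
  have nW : p \in W' -> ~~ connect g (pr u') (pr p).
    by move=> pW; apply/negP => /neq' H; apply: (notF (H _)); apply: inW'.
  split.
    apply/idP/idP => [|up]; first exact: inB'.
    by have := cov' p; case: (p \in B') => //= /nW; rewrite up.
  apply/idP/idP => [|up]; first exact: nW.
  by have := cov' p; case: (p \in W'); rewrite // orbF => /(inB' _ _ uB); rewrite (negbTE up).
have [uB|uB] := boolP (u \in B).
  have vW : v \in W.
    have := cov v; case vB: (v \in B) => //=.
    by rewrite (inB _ _ uB vB) in nuv.
  exists [set z | connect g (pr u) z].
  by split; apply/setP => p; rewrite !inE; case: (by_reach u v B W neq cov inB inW uB vW p).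
have uW : u \in W by have := cov u; rewrite (negbTE uB).
have vB : v \in B.
  have := cov v; case vW: (v \in W); last by rewrite orbF.
  by rewrite (inW _ _ uW vW) in nuv.
exists [set z | ~~ connect g (pr u) z].
have cov' p : (p \in W) || (p \in B) by rewrite orbC.
by split; apply/setP => p; rewrite !inE ?negbK;
  case: (by_reach u v W B neq cov' inW inB uW vB p).
Qed.

(** * From two rows or columns to the types *)

Lemma part2_compl (T : finType) (X : {set T}) : part2 X (~: X).
Proof. by split; rewrite ?setUCr // disjoints_subset setCK. Qed.

(** For two rows [r] and [s], the parts come in the order of types 7 and 8: only [r], only [s],
    neither, both. *)
Lemma part4_bool (T : finType) (r s : T -> bool) :
  part4 [set y | r y && ~~ s y] [set y | ~~ r y && s y]
        [set y | ~~ r y && ~~ s y] [set y | r y && s y].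
Proof.
split; [split|split|]; rewrite -?setI_eq0 -?subset0;
by [apply/subsetP => y; rewrite !inE; case: (r y) (s y) => [] []
   |apply/setP => y; rewrite !inE; case: (r y) (s y) => [] []].
Qed.

(** Quantifying over a class gives the common value of its rows, and still gives a row if the class
    is empty. *)
Lemma two_rowsE (T1 T2 : finType) (M : T1 -> T2 -> bool) : two_rows M ->
  exists (X : {set T1}) (r s : T2 -> bool),
    forall x y, M x y = if x \in X then r y else s y.
Proof.
case=> X MX; exists X, (fun y => [exists x in X, M x y]).
exists (fun y => [exists x in ~: X, M x y]) => x y; case: ifP => xX.
  apply/idP/exists_inP => [Mxy|[x' x'X]]; first by exists x.
  by rewrite (MX x x') // xX.
apply/idP/exists_inP => [Mxy|[x']]; first by exists x; rewrite // inE xX.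
by rewrite inE => x'X; rewrite (MX x x') // xX (negbTE x'X).
Qed.

Lemma two_rows_type8 (T1 T2 : finType) (B : {set T1 * T2}) :
  two_rows (fun x y => (x, y) \in B) -> type8 B (~: B).
Proof.
case/two_rowsE=> X [r [s MX]]; exists X, (~: X).
do 4!eexists; split; [exact: part2_compl | exact: (part4_bool r s) | |];
apply/setP => -[x y]; rewrite !inE MX;
by case: (x \in X) (r y) (s y) => [] [] [].
Qed.

Lemma two_cols_type7 (T1 T2 : finType) (B : {set T1 * T2}) :
  two_rows (fun y x => (x, y) \in B) -> type7 B (~: B).
Proof.
case/two_rowsE=> Y [r [s MY]].
exists [set x | r x && ~~ s x], [set x | ~~ r x && s x].
exists [set x | ~~ r x && ~~ s x], [set x | r x && s x], Y, (~: Y).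
split; [exact: part4_bool | exact: part2_compl | |];
apply/setP => -[x y]; rewrite !inE MY;
by case: (y \in Y) (r x) (s x) => [] [] [].
Qed.

Theorem theorem1p2 (T1 T2 : finType) (g : rel T1) (h : rel T2)
  (Hg : simple_graph g) (Hh : simple_graph h)
  (HgP3 : ~ graph_iso g P3_rel) (HgC4 : ~ graph_iso g C4_rel)
  (HhP3 : ~ graph_iso h P3_rel) (HhC4 : ~ graph_iso h C4_rel)
  (S : {set {set T1 * T2}})
  (HS : min_edge_cut (dprod_rel g h) S)
  (B W : {set T1 * T2})
  (HB : is_component (del_edges (dprod_rel g h) S) B)
  (HW : is_component (del_edges (dprod_rel g h) S) W)
  (HBW : [disjoint B & W]) (HBWcov : B :|: W = setT) :
  cut_shape B W \/ cut_shape W B.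
Proof.
(* The shapes found are of type 1, 2, 7 or 8, always for the pair in the given order. *)
left; case: Hg Hh HS => [g_sym g_irr] [h_sym h_irr] [cutS minS].
have e_sym : symmetric (dprod_rel g h).
  by move=> p q; rewrite /dprod_rel g_sym h_sym.
have fst_hom p q : del_edges (dprod_rel g h) S p q -> g p.1 q.1.
  by case/andP=> /andP[].
have snd_hom p q : del_edges (dprod_rel g h) S p q -> h p.2 q.2.
  by case/andP=> /andP[].
have [[x0 y0] p0B] : exists p, p \in B by apply/set0Pn; case: HB.
have [q0 q0W] : exists q, q \in W by apply/set0Pn; case: HW.
have WC : W = ~: B.
  apply/setP => p; have := disjointFr HBW (x := p).
  move/setP/(_ p): HBWcov; rewrite !inE.
  by case: (p \in B) => /= [_ ->|->].
have [gdis|gconn] := boolP [exists x, exists x', ~~ connect g x x'].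
  case/existsP: gdis => x /existsP[x' nxx'].
  have [X [eB eW]] := component_fibres (u := (x, y0)) (v := (x', y0))
    g_sym fst_hom HB HW HBWcov nxx'.
  left; exists X, (~: X); split; first exact: part2_compl.
    by apply/setP => p; rewrite eB !inE andbT.
  by apply/setP => p; rewrite eW !inE andbT.
have [hdis|hconn] := boolP [exists y, exists y', ~~ connect h y y'].
  case/existsP: hdis => y /existsP[y' nyy'].
  have [X [eB eW]] := component_fibres (u := (x0, y)) (v := (x0, y'))
    h_sym snd_hom HB HW HBWcov nyy'.
  right; left; exists X, (~: X); split; first exact: part2_compl.
    by apply/setP => p; rewrite eB !inE.
  by apply/setP => p; rewrite eW !inE.
have g_conn x x' : connect g x x'.
  by move: gconn; rewrite negb_exists => /forallP/(_ x); rewrite negb_exists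
    => /forallP/(_ x'); rewrite negbK.
have h_conn y y' : connect h y y'.
  by move: hconn; rewrite negb_exists => /forallP/(_ y); rewrite negb_exists
    => /forallP/(_ y'); rewrite negbK.
have cost (A : {set T1 * T2}) : coloring_cost g h (fun x y => (x, y) \in A) =
    2 * #|cutset (dprod_rel g h) A|.
  have pairs (F : T1 * T2 -> nat) : \sum_p F p = \sum_x \sum_y F (x, y).
    by rewrite pair_bigA; apply: eq_bigr => -[].
  rewrite card_cutset // pairs; apply: eq_bigr => x _.
  under [RHS]eq_bigr => y _ do rewrite pairs.
  rewrite exchange_big /=; apply: eq_bigr => x' _.
  rewrite big_distrr /=; apply: eq_bigr => y _.
  rewrite big_distrr /=; apply: eq_bigr => y' _.
  by rewrite mulnA /dprod_rel mulnb.
(* An edge leaving [B] that survives the deletion of [S] would extend the component. *)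
have cutBS : cutset (dprod_rel g h) B \subset S.
  apply/subsetP => s /imsetP[[u v]]; rewrite inE /= => /and3P[euv uB vB] ->.
  apply: contraNT vB => nS; case: HB => _ /(_ u uB v) <-.
  by apply: connect1; rewrite /del_edges euv.
have nonconstB : nonconstant (fun x y => (x, y) \in B).
  exists x0, q0.1, y0, q0.2; rewrite p0B -surjective_pairing.
  by move: q0W; rewrite WC inE => /negbTE->.
(* The cutset of [B] is at most as large as [S], which is at most as large as the cutset of any set
   given by a nonconstant coloring. *)
have minB N : nonconstant N ->
    coloring_cost g h (fun x y => (x, y) \in B) <= coloring_cost g h N.
  move=> ncN; pose A := [set p | N p.1 p.2].
  have -> : coloring_cost g h N = coloring_cost g h (fun x y => (x, y) \in A).
    apply: eq_bigr => x _; apply: eq_bigr => x' _; congr (_ * _).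
    by apply: eq_row_cut => y; rewrite inE.
  rewrite !cost leq_mul2l /=; apply: leq_trans (subset_leq_card cutBS) _.
  apply: minS; case: ncN => x [x' [y [y' ne]]].
  have [Nxy|Nxy] := boolP (N x y).
    apply: (@edge_cut_cutset _ _ _ (x, y) (x', y')); rewrite ?inE //=.
    by move: ne; rewrite Nxy; case: (N x' y').
  apply: (@edge_cut_cutset _ _ _ (x', y') (x, y)); rewrite ?inE //=.
  by move: ne; rewrite (negbTE Nxy); case: (N x' y').
rewrite WC; case: (minimal_coloring g_sym g_irr g_conn h_sym h_irr h_conn
  HgP3 HgC4 HhP3 HhC4 nonconstB minB) => two.
  by do 7!right; apply: two_rows_type8.
by do 6!right; left; apply: two_cols_type7.
Qed.
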